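(* There exists an Arnoux-Rauzy word $w_\infty$ such that for all $(a,b,c)\in\mathbb{Z}^3$ there exist factors $u,v\in\mathcal{F}(w_\infty)$ satisfying $\mathrm{ab}(u)-\mathrm{ab}(v)=(a,b,c)$.
   Context: Let $A=\{1,2,3\}$, let $A^*$ be the set of finite words over $A$ and $A^{\mathbb{N}}$ the set of infinite words ($\mathbb{N}=\{0,1,2,\dots\}$). A finite word $u=u[0]\cdots u[n-1]$ is a factor of a (finite or infinite) word $w$ if there is $i\ge 0$ with $w[i+k]=u[k]$ for all $0\le k\le n-1$. $\mathcal{F}(w)$ denotes the set of all factors of $w$ (of all lengths). For a finite word $u$, $\mathrm{ab}(u)=(|u|_1,|u|_2,|u|_3)\in\mathbb{Z}^3$, where $|u|_\alpha$ is the number of occurrences of $\alpha$ in $u$. Arnoux-Rauzy words. For $i\in A$ the Arnoux-Rauzy substitution $\sigma_i: A\to A^*$ is $\sigma_i(i)=i$, $\sigma_i(j)=ij$ for $j\in A\setminus\{i\}$, extended to a morphism for concatenation on $A^*$ and on $A^{\mathbb{N}}$. A sequence of finite words $(u_n)$ converges to an infinite word $w$ if for every sequence $(v_n)$ of infinite words, $u_n\cdot v_n$ converges to $w$ for the distance $\delta(x,y)=2^{-\min\{n: x[n]\ne y[n]\}}$ (and $\delta(x,x)=0$). If $(s_n)_{n\in\mathbb{N}}\in\{\sigma_1,\sigma_2,\sigma_3\}^{\mathbb{N}}$ contains infinitely many occurrences of each of $\sigma_1,\sigma_2,\sigma_3$, then for $\alpha\in A$ the sequence of finite words $s_0\circ\cdots\circ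 s_{n-1}(\alpha)$ converges to an infinite word $w_0$ not depending on $\alpha$; the words $w_0$ so obtained are the standard Arnoux-Rauzy words. An infinite word over $A$ is an Arnoux-Rauzy word if it has the same set of factors as some standard Arnoux-Rauzy word. *)

(* Defs.v *)
From mathcomp Require Import all_boot all_order all_algebra.
From mathcomp Require Import boolp classical_sets.

Set Implicit Arguments.
Unset Strict Implicit.
Unset Printing Implicit Defensive.

Import Order.TTheory GRing.Theory Num.Theory.

Local Open Scope classical_set_scope.
Local Open Scope ring_scope.

(* The letters 1, 2, 3 are the ordinals of values 0, 1, 2. *)
Definition letter := 'I_3.
Definition word := seq letter.
Definition iword := nat -> letter.

Definition factors (w : iword) : set word :=
  [set u | exists i : nat,
     forall k : 'I_(size u), w (i + k)%N = tnth (in_tuple u) k].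

Definition ab (u : word) : 'rV[int]_3 := \row_i (count_mem i u)%:Z.

Definition sigma (i j : letter) : word := if j == i then [:: i] else [:: i; j].

Definition extend (s : letter -> word) (u : word) : word := flatten (map s u).

(* Letters past the end of [u] are supplied by the default value of [nth]. *)
Definition concat (u : word) (v : iword) : iword :=
  fun k => nth (v (k - size u)%N) u k.

Definition delta (x y : iword) : rat :=
  if pselect (exists n, x n != y n) is left neq_xy
  then 2 ^- ex_minn neq_xy else 0.

(* [delta] only takes rational values, so rational [eps] suffice. *)
Definition icvg (x : nat -> iword) (w : iword) : Prop :=
  forall eps : rat, 0 < eps ->
    exists N : nat, forall n : nat, (N <= n)%N -> delta (x n) w < eps.

Definition wcvg (u : nat -> word) (w : iword) : Prop :=
  forall v : nat -> iword, icvg (fun n => concat (u n) (v n)) w.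

(* [d] is the sequence of indices of the substitutions:                       *)
(* [sigma_comp d n] is sigma_(d 0) \o ... \o sigma_(d n.-1).                  *)
Definition sigma_comp (d : nat -> letter) (n : nat) (u : word) : word :=
  foldr (fun i => extend (sigma i)) u (mkseq d n).

Definition standard_arnoux_rauzy (w0 : iword) : Prop :=
  exists2 d : nat -> letter,
    (forall (i : letter) (N : nat), exists2 n, (N <= n)%N & d n = i) &
    (forall alpha : letter, wcvg (fun n => sigma_comp d n [:: alpha]) w0).

Definition arnoux_rauzy (w : iword) : Prop :=
  exists2 w0, standard_arnoux_rauzy w0 & factors w = factors w0.

(* Main.v *)
(* Let D(w) be the set of differences ab u - ab v over factors u, v of w, and *)
(* let F_i be the linear map replacing coordinate i by the sum of the three   *)
(* coordinates, so that ab (sigma_i u) = F_i (ab u).  A letter i may be added *)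
(* after sigma_i u, or removed from its front, so D(sigma_i w) contains       *)
(* F_i t + k e_i for all t in D(w) and |k| <= 2.  Starting from 0, these      *)
(* moves reach every vector of Z^3.  Hence for each t there is a finite       *)
(* composition of substitutions forcing t to be in D, whatever word it is     *)
(* applied to; as the F_i are bijective on Z^3, this can also be achieved     *)
(* after any prescribed finite composition.  Enumerating Z^3 and              *)
(* concatenating the resulting blocks, each followed by the three letters,    *)
(* gives the sequence of substitutions of the required word.                  *)

Require Import Defs.
From mathcomp Require Import all_boot all_order all_algebra.
From mathcomp Require Import boolp classical_sets zify.

Set Implicit Arguments.
Unset Strict Implicit.
Unset Printing Implicit Defensive.

Import Order.TTheory GRing.Theory Num.Theory.

Local Open Scope classical_set_scope.
Local Open Scope ring_scope.

(** The arithmetic core is [R_all]: triples are reached by undoing moves until two coordinates are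
    opposite, the case of [R_antidiag]. [deep_in_sigma] turns each move into an operation on
    factors, whence [realizable], and [realizable_after] for a prescribed initial block.
    [directive_sequence] handles all targets in turn; [standard_limit] supplies the limit word,
    which has every [bispecial (mkseq d n)] as a prefix. *)

Section Reach.
Variable R : int -> int -> int -> Prop.
Hypothesis R0 : R 0 0 0.
Hypothesis R_step : forall a b c k : int,
  -2 <= k <= 2 -> R a b c -> R (a + b + c + k) b c.
Hypothesis R_swap12 : forall a b c : int, R a b c -> R b a c.
Hypothesis R_swap23 : forall a b c : int, R a b c -> R a c b.
Hypothesis R_opp : forall a b c : int, R a b c -> R (- a) (- b) (- c).

Lemma R_iter (q : nat) (a b c j : int) :
  - 2 * q%:Z <= j <= 2 * q%:Z -> R (a - q%:Z * (b + c) + j) b c -> R a b c.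
Proof.
elim: q a j => [|q IHq] a j j_bd.
  by have ->: a - 0%:Z * (b + c) + j = a by lia.
have [k [k_bd jk_bd]] : exists k : int,
    -2 <= k <= 2 /\ - 2 * q%:Z <= j - k <= 2 * q%:Z.
  case: (leP j (- 2)) => ?; first by exists (- 2); lia.
  case: (leP 2 j) => ?; first by exists 2; lia.
  by exists j; lia.
move=> Rj; have ->: a = (a - (b + c) + k) + b + c + - k by lia.
apply: R_step; first by lia.
apply: (IHq _ (j - k)) => //.
by have ->: a - (b + c) + k - q%:Z * (b + c) + (j - k)
          = a - q.+1%:Z * (b + c) + j by lia.
Qed.

(** A move drifts the first coordinate by [b + c], at most 1 in size, while [k] allows 2, so one
    unit per move can be gained in either direction. *)
Lemma R_free (x a b c : int) : -1 <= b + c <= 1 -> R x b c -> R a b c.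
Proof.
move=> bc_bd Rx.
apply: (@R_iter `|x - a| _ _ _ (x - a + `|x - a|%N%:Z * (b + c))).
  by nia.
by have ->: a - `|x - a|%N%:Z * (b + c) + (x - a + `|x - a|%N%:Z * (b + c)) = x
  by lia.
Qed.

(** With [r = - (b + c)], undoing [q] moves adds [q * r] up to a slack of [2 * q]. The quadratic gap
    gives [r <= q], so the slack covers the remainder modulo [r]. *)
Lemma R_up (x a b c : int) :
  b + c < 0 -> a + (b + c) ^+ 2 <= x -> R x b c -> R a b c.
Proof.
move=> bc_lt0 le_x Rx; pose r := - (b + c).
have r_gt0 : 0 < r by lia.
pose q := ((x - a) %/ r)%Z; pose m := ((x - a) %% r)%Z.
have xE : x - a = q * r + m by exact: divz_eq.
have m_ge0 : 0 <= m by apply: modz_ge0; lia.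
have m_ltr : m < r by apply: ltz_pmod.
have r2_le : r * r <= x - a by move: le_x; rewrite expr2 /r; lia.
have r_leq : r <= q by nia.
apply: (@R_iter `|q| _ _ _ m); first by lia.
have ->: a - `|q|%N%:Z * (b + c) + m = x; last by [].
have ->: `|q|%N%:Z = q by lia.
by rewrite (_ : b + c = - r); lia.
Qed.

(* By R_free, (x, -n, n) reduces to (n-1, -n, n); there the first two          *)
(* coordinates sum to -1, so R_free again turns n into 1-n, which is the      *)
(* case n-1 up to permutation.                                                *)
Lemma R_antidiag (n : nat) (x : int) : R x (- n%:Z) n%:Z.
Proof.
elim: n x => [|n IHn] x; first by apply: (@R_free 0) => //; lia.
apply: (@R_free n%:Z); first by lia.
apply: R_swap23; apply: R_swap12.
apply: (@R_free (- n%:Z)); first by lia.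
apply: R_swap23; apply: R_swap12; exact: IHn.
Qed.

Lemma R_neg (a b c : int) : b + c < 0 -> b <= c -> R a b c.
Proof.
move=> bc_lt0 le_bc; pose r := c + 1 - b.
(* Undoing moves: (a, b, c) -> (L, b, c) -> (L, -L - r, c) -> (L, -L - r, C)   *)
(* -> (-C, -L - r, C), where the last arrow uses two moves and               *)
(* L - 2 (C - L - r) = - C.                                                  *)
pose L := `|a| + (b + c) ^+ 2 + `|c| + r ^+ 2.
have r2_ge0 : 0 <= r ^+ 2 by apply: sqr_ge0.
have bc2_ge0 : 0 <= (b + c) ^+ 2 by apply: sqr_ge0.
(* These bounds serve the two uses of [R_up], the second because [L <= C]. *)
have L_ge : [/\ 0 <= L, a + (b + c) ^+ 2 <= L & c + r ^+ 2 <= L].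
  by rewrite /L; split; lia.
case: L_ge; move: L => L L_ge0 La Lc.
pose C := 3 * L + 2 * r; have r_gt0 : 0 < r by lia.
apply: (@R_up L) => //.
apply: R_swap12; apply: (@R_iter 1 _ _ _ (-1)); first by lia.
have ->: b - 1%:Z * (L + c) - 1 = - L - r by lia.
apply: R_swap23; apply: R_swap12; apply: (@R_up C); first by lia.
  have ->: (- L - r + L) ^+ 2 = r ^+ 2 by rewrite -sqrrN; congr (_ ^+ 2); lia.
  by lia.
apply: R_swap23; apply: R_swap12.
have LC : L - 2%:Z * (C + (- L - r)) + 0 = - C by lia.
apply: (@R_iter 2 _ _ _ 0); rewrite ?LC //.
have ->: C = `|C|%N%:Z by lia.
apply: R_swap12; apply: R_swap23; apply: R_swap12; apply: R_swap23.
exact: R_antidiag.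
Qed.

Lemma R_all (a b c : int) : R a b c.
Proof.
have R_neg' x y z : y + z < 0 -> R x y z.
  case: (leP y z) => yz yz_lt0; first exact: R_neg.
  by apply: R_swap23; apply: R_neg; lia.
case: (ltgtP (b + c) 0) => bc0; first exact: R_neg'.
  rewrite -[a]opprK -[b]opprK -[c]opprK; apply: R_opp.
  by apply: R_neg'; lia.
case: (leP 0 c) => c0; last apply: R_swap23.
  have [-> ->] : b = - `|c|%N%:Z /\ c = `|c|%N%:Z by lia.
  exact: R_antidiag.
have [-> ->] : c = - `|b|%N%:Z /\ b = `|b|%N%:Z by lia.
exact: R_antidiag.
Qed.
End Reach.

(** * Lengths and letter counts under substitutions *)

Notation sigmas q u := (foldr (fun i => extend (sigma i)) u q).

Lemma extend_cat s (u v : word) : extend s (u ++ v) = extend s u ++ extend s v.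
Proof. by rewrite /extend map_cat flatten_cat. Qed.

Lemma sigmas_cat q (u v : word) : sigmas q (u ++ v) = sigmas q u ++ sigmas q v.
Proof. by elim: q => //= i q ->; rewrite extend_cat. Qed.

Lemma count_sigma i j (u : word) :
  count_mem j (extend (sigma i) u) = if j == i then size u else count_mem j u.
Proof.
elim: u => [|a u IHu]; first by case: ifP.
rewrite /extend /= count_cat [count _ (flatten _)]IHu /sigma.
case: (eqVneq a i) => [->|/negbTE ai]; case: (eqVneq j i) => [->|ji] /=;
  rewrite ?eqxx.
- by [].
- by rewrite eq_sym (negbTE ji).
- by rewrite ai; lia.
- by rewrite [i == j]eq_sym (negbTE ji); lia.
Qed.

Lemma size_sigma i (u : word) :
  size (extend (sigma i) u) = (size u + count (predC1 i) u)%N.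
Proof.
elim: u => // a u IHu; rewrite /extend /= size_cat [size (flatten _)]IHu /sigma.
by case: eqVneq => _ /=; lia.
Qed.

Lemma size_sigma_ge i (u : word) : (size u <= size (extend (sigma i) u))%N.
Proof. by rewrite size_sigma leq_addr. Qed.

Lemma size_sigmas_ge q (u : word) : (size u <= size (sigmas q u))%N.
Proof. by elim: q => //= i q IHq; apply: leq_trans IHq (size_sigma_ge _ _). Qed.

Lemma sigma_consP i (u : word) :
  (0 < size u)%N -> extend (sigma i) u = i :: behead (extend (sigma i) u).
Proof. by case: u => // a u _; rewrite /extend /= /sigma; case: ifP. Qed.

(** * Abelianization and incidence maps *)

Definition wt (t : 'rV[int]_3) : int := \sum_k t 0 k.

Definition incid (i : letter) (t : 'rV[int]_3) : 'rV[int]_3 :=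
  t + (wt t - t 0 i) *: delta_mx 0 i.

Lemma wtD t t' : wt (t + t') = wt t + wt t'.
Proof. by rewrite /wt -big_split; apply: eq_bigr => k _; rewrite mxE. Qed.

Lemma wtZ a t : wt (a *: t) = a * wt t.
Proof. by rewrite /wt mulr_sumr; apply: eq_bigr => k _; rewrite mxE. Qed.

Lemma wt_delta i : wt (delta_mx 0 i) = 1.
Proof.
rewrite /wt (bigD1 i) //= big1 ?mxE ?eqxx ?addr0 // => k /negbTE ki.
by rewrite mxE ki andbF.
Qed.

Lemma incidB i t t' : incid i (t - t') = incid i t - incid i t'.
Proof.
apply/rowP=> l; rewrite /incid wtD -[- t']scaleN1r wtZ !mxE /=.
by case: (l == i); lia.
Qed.

Lemma incid_surj i t : exists t', t = incid i t'.
Proof.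
exists (t + (t 0 i - wt t) *: delta_mx 0 i).
apply/rowP=> l; rewrite /incid wtD wtZ wt_delta !mxE !eqxx /=.
by case: eqVneq => [->|_]; lia.
Qed.

Lemma ab_cat (u v : word) : ab (u ++ v) = ab u + ab v.
Proof. by apply/rowP=> k; rewrite !mxE count_cat PoszD. Qed.

Lemma ab1 i : ab [:: i] = delta_mx 0 i.
Proof. by apply/rowP=> k; rewrite !mxE /= addn0 eq_sym; case: eqP. Qed.

Lemma wt_ab (u : word) : wt (ab u) = (size u)%:Z.
Proof.
elim: u => [|a u IHu]; first by rewrite /wt big1 // => k _; rewrite mxE.
by rewrite -cat1s ab_cat wtD IHu ab1 wt_delta.
Qed.

Lemma ab_sigma i (u : word) : ab (extend (sigma i) u) = incid i (ab u).
Proof.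
apply/rowP=> k; rewrite /incid wt_ab !mxE count_sigma /=.
by case: eqVneq => [->|ki] /=; lia.
Qed.

(** * Forcing a prescribed difference *)

Definition deep_in (N : nat) (z u : word) : Prop := exists p s : word,
  [/\ z = p ++ u ++ s, (N <= size u)%N & (N <= size s)%N].

(** Images of nonempty words begin with [i]: the image of [u] can lose its first letter, or gain the
    first letter of the image of [s]. *)
Lemma deep_in_sigma N i (z u : word) (e : int) : -1 <= e <= 1 ->
  deep_in N.+1 z u -> exists2 u', deep_in N (extend (sigma i) z) u' &
    ab u' = incid i (ab u) + e *: delta_mx 0 i.
Proof.
move=> e_bd [p [s [-> Nu Ns]]]; rewrite !extend_cat.
have Nu' := leq_trans Nu (size_sigma_ge i u).
have Ns' := leq_trans Ns (size_sigma_ge i s).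
have uE := @sigma_consP i u (leq_trans (ltn0Sn N) Nu).
have sE := @sigma_consP i s (leq_trans (ltn0Sn N) Ns).
rewrite -ab_sigma.
move: Nu' Ns' uE sE; set u' := extend _ u; set s' := extend _ s.
set p' := extend _ p => Nu' Ns' uE sE.
have [-> | [-> | ->]] : e = 0 \/ e = 1 \/ e = -1 by lia.
- exists u'; last by rewrite scale0r addr0.
  by exists p', s'; split=> //; exact: ltnW.
- exists (u' ++ [:: i]); last by rewrite ab_cat ab1 scale1r.
  exists p', (behead s'); rewrite size_cat size_behead; split; try lia.
  by rewrite -catA /= -sE.
exists (behead u').
  exists (p' ++ [:: i]), s'; rewrite size_behead; split; try lia.
  by rewrite -!catA cat1s -cat_cons -uE.
by rewrite uE -cat1s ab_cat ab1 /= scaleN1r addrAC subrr add0r.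
Qed.

(* The margin N pays for the letters removed by the later moves.              *)
Definition realized (q : seq letter) (t : 'rV[int]_3) : Prop :=
  forall N : nat, exists L : nat, forall z : word, (L <= size z)%N ->
    exists u v : word, [/\ deep_in N (sigmas q z) u,
      deep_in N (sigmas q z) v & ab u - ab v = t].

Lemma realized_nil : realized [::] 0.
Proof.
move=> N; exists (N + N)%N => z Lz; exists (take N z), (take N z).
have tN : deep_in N z (take N z).
  exists [::], (drop N z); rewrite /= cat_take_drop size_takel ?size_drop //.
    by split=> //; lia.
  by lia.
by split=> //; rewrite subrr.
Qed.

Lemma realized_opp q t : realized q t -> realized q (- t).
Proof.
move=> qt N; have [L Lq] := qt N; exists L => z /Lq [u [v [zu zv <-]]].
by exists v, u; rewrite opprB.
Qed.

Lemma realized_cons q t i (k : int) : -2 <= k <= 2 -> realized q t ->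
  realized (i :: q) (incid i t + k *: delta_mx 0 i).
Proof.
move=> k_bd qt N; have [L Lq] := qt N.+1; exists L => z /Lq [u [v [zu zv tE]]].
(* The correction [k] is shared between the two factors. *)
have [e [f [e_bd f_bd kE]]] : exists e f : int,
    [/\ -1 <= e <= 1, -1 <= f <= 1 & k = e - f].
  case: (leP k (-1)) => ?; first by exists (-1), (- 1 - k); split; lia.
  case: (leP 1 k) => ?; first by exists 1, (1 - k); split; lia.
  by exists k, 0; split; lia.
have [u' zu' u'E] := deep_in_sigma i e_bd zu.
have [v' zv' v'E] := deep_in_sigma i f_bd zv.
exists u', v'; split=> //.
by rewrite u'E v'E -tE incidB kE scalerBl opprD addrACA.
Qed.

Lemma realized_catr Q q t : realized Q t -> realized (Q ++ q) t.
Proof.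
move=> Qt N; have [L LQ] := Qt N; exists L => z Lz; rewrite foldr_cat.
exact: LQ (leq_trans Lz (size_sigmas_ge _ _)).
Qed.

Lemma realizable t : exists q, realized q t.
Proof.
(* Quantifying over all orderings of the letters makes the swap hypotheses immediate. *)
pose R (a b c : int) := forall x y z : letter, uniq [:: x; y; z] ->
  exists q, realized q
    (a *: delta_mx 0 x + b *: delta_mx 0 y + c *: delta_mx 0 z).
have R_all : forall a b c, R a b c.
  apply: R_all.
  - move=> x y z _; exists [::]; rewrite !scale0r !addr0; exact: realized_nil.
  - move=> a b c k k_bd Rabc x y z xyz; have [q qt] := Rabc x y z xyz.
    exists (x :: q); have := realized_cons x k_bd qt.
    congr realized; rewrite /incid !wtD !wtZ !wt_delta !mxE !eqxx /=.
    move: xyz; rewrite /= !inE negb_or andbT => /andP[/andP[xy xz] _].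
    by apply/rowP=> l; rewrite !mxE (negbTE xy) (negbTE xz) /=; lia.
  - move=> a b c Rabc x y z xyz; have [|q qt] := Rabc y x z.
      move: xyz; rewrite /= !inE !negb_or eq_sym.
      by case: (_ != _); case: (_ != _).
    by exists q; rewrite [X in X + _]addrC.
  - move=> a b c Rabc x y z xyz; have [|q qt] := Rabc x z y.
      move: xyz; rewrite /= !inE !negb_or [z == y]eq_sym.
      by do 3!case: (_ != _).
    by exists q; rewrite addrAC.
  - move=> a b c Rabc x y z xyz; have [q qt] := Rabc x y z xyz; exists q.
    by rewrite !scaleNr -!opprD; apply: realized_opp.
have [q qt] := R_all (t 0 0) (t 0 1) (t 0 2%:R) 0 1 2%:R isT.
exists q; move: qt; congr realized; apply/rowP=> k; rewrite !mxE /=.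
by case: k => [[|[|[|]]] lk] //=; rewrite ?(mulr0, mulr1, addr0, add0r);
   congr (t _ _); apply: val_inj.
Qed.

(** Incidence maps are onto, so the target is pulled back through [Q]. *)
Lemma realizable_after Q t : exists q, realized (Q ++ q) t.
Proof.
elim: Q t => [|i Q IHQ] t; first exact: realizable.
have [t' ->] := incid_surj i t; have [q qt'] := IHQ t'; exists q.
rewrite -[incid i t']addr0 -(scale0r (delta_mx 0 i)).
exact: realized_cons.
Qed.


(** * Convergence to a standard word *)

Lemma prefix_limit (Q : nat -> word) :
    (forall n, prefix (Q n) (Q n.+1)) -> (forall n, (n <= size (Q n))%N) ->
  exists w : iword, forall n, mkseq w (size (Q n)) = Q n.
Proof.
move=> Qpre Qsize; exists (fun n => nth ord0 (Q n.+1) n) => n.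
have Qmono m k : (m <= k)%N -> prefix (Q m) (Q k).
  move=> mk; rewrite -(subnK mk).
  elim: (k - m)%N => [|j IHj]; first exact: prefix_refl.
  exact: prefix_trans IHj (Qpre _).
have nth_pre (u v : word) k : prefix u v -> (k < size u)%N ->
    nth ord0 v k = nth ord0 u k.
  by case/prefixP=> s -> ku; rewrite nth_cat ku.
apply: (@eq_from_nth _ ord0); rewrite size_mkseq // => k kQ.
rewrite nth_mkseq //; case: (leqP k.+1 n) => kn.
  by apply/esym/nth_pre; rewrite ?Qmono //; apply: Qsize.
by apply: nth_pre => //; apply: Qmono; apply: ltnW.
Qed.

(* The longest common prefix of the words sigmas q z, for z infinite.         *)
Fixpoint bispecial (q : seq letter) : word :=
  if q is i :: q' then extend (sigma i) (bispecial q') ++ [:: i] else [::].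

Lemma bispecial_cat q r :
  bispecial (q ++ r) = sigmas q (bispecial r) ++ bispecial q.
Proof. by elim: q => [|i q IHq] /=; rewrite ?cats0 // IHq extend_cat -catA. Qed.

Lemma size_bispecial q : (size q <= size (bispecial q))%N.
Proof.
elim: q => //= i q IHq; rewrite size_cat addn1 ltnS.
exact: leq_trans IHq (size_sigma_ge _ _).
Qed.

(** Whatever follows the inductive prefix has an image starting with [i]; if nothing follows, the
    final [[:: i]] supplies that letter. *)
Lemma prefix_sigmas_bispecial q (z : word) :
  prefix (bispecial q) (sigmas q z ++ bispecial q).
Proof.
elim: q => [|i q /prefixP[y yE]] /=; first exact: prefix0s.
rewrite catA -extend_cat yE extend_cat -catA prefix_catr // eqxx /=.
case: y {yE} => [|a y]; first exact: prefix_refl.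
by rewrite (@sigma_consP i (a :: y)) // cat_cons -cat1s prefix_prefix.
Qed.

Lemma prefix_bispecial_cat q r : prefix (bispecial q) (bispecial (q ++ r)).
Proof. by rewrite bispecial_cat; apply: prefix_sigmas_bispecial. Qed.

Lemma prefix_sigmas q (z : word) : (size (bispecial q) <= size z)%N ->
  prefix (bispecial q) (sigmas q z).
Proof.
move=> qz; have := prefix_sigmas_bispecial q z.
have le_q := leq_trans qz (size_sigmas_ge q z).
by rewrite !prefixE takel_cat.
Qed.

Lemma mem_sigma i (u : word) : {subset u <= extend (sigma i) u}.
Proof.
move=> j; rewrite -!has_pred1 !has_count count_sigma; case: eqP => // _.
by move/leq_trans; apply; apply: count_size.
Qed.

(** Once [j] is applied, both [alpha] and [j] occur, so every further substitution inserts a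
    letter. *)
Lemma size_sigmas_letter q1 q2 (alpha j : letter) : j != alpha ->
  (size q1 < size (sigmas (q1 ++ j :: q2) [:: alpha]))%N.
Proof.
move=> j_alpha; set u := sigmas _ _.
suff [] : [/\ alpha \in u, j \in u & (size q1 < size u)%N] by [].
have alpha_in q : alpha \in sigmas q [:: alpha].
  by elim: q => [|i q IHq] /=; [rewrite inE | apply: mem_sigma].
rewrite {}/u; elim: q1 => [|i q1 [IHa IHj IHs]] /=.
  have u_gt0 : (0 < size (sigmas q2 [:: alpha]))%N.
    exact: size_sigmas_ge q2 [:: alpha].
  split; first by apply: mem_sigma; apply: alpha_in.
    by rewrite sigma_consP ?inE ?eqxx.
  exact: leq_trans u_gt0 (size_sigma_ge _ _).
split; [exact: mem_sigma | exact: mem_sigma |].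
move: IHa IHj IHs; set v := sigmas _ _ => va vj vs.
apply: (@leq_ltn_trans (size v)) => //.
have [l lv li] : exists2 l, l \in v & l != i.
  by case: (eqVneq j i) => [<-|]; [exists alpha; rewrite 1?eq_sym | exists j].
rewrite size_sigma -[X in (X < _)%N]addn0 ltn_add2l -has_count.
by apply/hasP; exists l.
Qed.

Lemma delta_le (x y : iword) N :
  (forall k, (k < N)%N -> x k = y k) -> delta x y <= 2 ^- N.
Proof.
move=> xy; rewrite /delta; case: pselect => [neq_xy|_]; last first.
  by rewrite invr_ge0 exprn_ge0.
case: ex_minnP => m neq_m _.
rewrite lef_pV2 ?posrE ?exprn_gt0 // ler_eXn2l ?ltr1n //.
by rewrite leqNgt; apply/negP => /xy xym; rewrite xym eqxx in neq_m.
Qed.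

Lemma mkseqD (T : Type) (f : nat -> T) m n :
  mkseq f (m + n) = mkseq f m ++ mkseq (fun k => f (m + k)%N) n.
Proof.
rewrite /mkseq iotaD map_cat add0n; congr (_ ++ _).
by rewrite -[m in iota m]addn0 iotaDl -map_comp.
Qed.

Lemma factors_prefix (w : iword) n (p u s : word) :
  mkseq w n = p ++ u ++ s -> factors w u.
Proof.
move=> wE; exists (size p) => k.
have nE : n = (size p + (size u + size s))%N.
  by rewrite -(size_mkseq w n) wE !size_cat.
rewrite (tnth_nth ord0) /= -[w _](@nth_mkseq _ ord0 w n).
  by rewrite wE nth_cat ltnNge leq_addr /= addKn nth_cat ltn_ord.
by rewrite nE ltn_add2l (leq_trans (ltn_ord k)) ?leq_addr.
Qed.

Lemma standard_limit (d : nat -> letter) :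
    (forall (i : letter) (N : nat), exists2 n, (N <= n)%N & d n = i) ->
  exists2 w0 : iword, standard_arnoux_rauzy w0 &
  forall n, mkseq w0 (size (bispecial (mkseq d n))) = bispecial (mkseq d n).
Proof.
move=> d_inf; have [||w0 w0E] := @prefix_limit (fun n => bispecial (mkseq d n)).
- by move=> n; rewrite -[n.+1]addn1 mkseqD; apply: prefix_bispecial_cat.
- by move=> n; rewrite -[X in (X <= _)%N](size_mkseq d n) size_bispecial.
exists w0 => //; exists d => // alpha v eps eps_gt0.
have [N N_eps] : exists N : nat, 2 ^- N < eps :> rat.
  exists (Num.truncn eps^-1).+1.
  rewrite invf_plt ?posrE ?exprn_gt0 //.
  apply: lt_trans (truncnS_gt _) _; rewrite -natrX ltr_nat; exact: ltn_expl.
pose B := size (bispecial (mkseq d N)).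
have [j j_alpha] : exists j : letter, j != alpha.
  by case: (eqVneq alpha 0) => [->|]; [exists 1 | exists 0; rewrite eq_sym].
(* The [K - N >= B] substitutions between ranks [N] and [K] make the word long enough for
   [prefix_sigmas]. *)
have [K NBK dK] := d_inf j (N + B).
exists K.+1 => n Kn; apply: le_lt_trans N_eps; apply: delta_le => k kN.
have pre : prefix (bispecial (mkseq d N)) (sigma_comp d n [:: alpha]).
  have -> : n = (N + ((K - N) + (1 + (n - K.+1))))%N by lia.
  rewrite /sigma_comp !mkseqD foldr_cat; apply: prefix_sigmas.
  rewrite [mkseq _ 1]/mkseq /= addn0 subnKC; last by lia.
  apply/ltnW/leq_ltn_trans/(size_sigmas_letter _ _ (j := d K)); rewrite ?dK //.
  by rewrite size_mkseq -/B; lia.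
have kB : (k < B)%N.
  by apply: leq_trans kN _; rewrite -[N](size_mkseq d N) size_bispecial.
case/prefixP: pre => s ->.
rewrite /concat (set_nth_default ord0) ?nth_cat ?kB.
  by rewrite -w0E nth_mkseq.
by rewrite size_cat (leq_trans kB) ?leq_addr.
Qed.

(** * Assembling the directive sequence and the word *)

Lemma directive_sequence : exists2 d : nat -> letter,
  (forall (i : letter) (N : nat), exists2 n, (N <= n)%N & d n = i) &
  (forall t, exists n, realized (mkseq d n) t).
Proof.
pose next Q t := sval (cid (realizable_after Q t)).
pose letters : seq letter := enum 'I_3.
pose target k : 'rV[int]_3 := odflt 0 (unpickle k).
pose step k Q := (Q ++ next Q (target k)) ++ letters.
pose Q := fix Q n := if n is k.+1 then step k (Q k) else [::].
have sizeQ n : (n <= size (Q n))%N.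
  elim: n => //= n IHn; rewrite /step !size_cat size_enum_ord; lia.
have preQ n : prefix (Q n) (Q n.+1).
  by rewrite /= /step -catA prefix_prefix.
have [d dE] := prefix_limit preQ sizeQ.
exists d => [i N|t].
  (* The position of [i] among the letters appended at stage [N]. *)
  pose m := (size (Q N ++ next (Q N) (target N)) + i)%N.
  exists m; first by rewrite /m size_cat; have := sizeQ N; lia.
  rewrite -[d m](@nth_mkseq _ ord0 _ (size (Q N.+1))); last first.
    by rewrite /= /step !size_cat /m size_cat size_enum_ord ltn_add2l.
  rewrite dE /= /step nth_cat /m ltnNge leq_addr /= addKn.
  by rewrite nth_ord_enum.
exists (size (Q (pickle t).+1)); rewrite dE /= /step; apply: realized_catr.
have -> : target (pickle t) = t by rewrite /target pickleK.
exact: svalP (cid (realizable_after _ _)).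
Qed.

Theorem proposition1 :
  exists2 w : iword, arnoux_rauzy w &
    forall t : 'rV[int]_3, exists u v : word,
      [/\ factors w u, factors w v & ab u - ab v = t].
Proof.
have [d d_inf d_real] := directive_sequence.
have [w0 w0_std w0E] := standard_limit d_inf.
exists w0 => [|t]; first by exists w0.
have [n /(_ 0%N) [L realL]] := d_real t.
(* By [bispecial_cat], the image of this [z] under the first [n] substitutions is a prefix of
   [w0]. *)
pose z := bispecial (mkseq (fun k => d (n + k)%N) L).
have [|u [v [[p [s [zu _ _]]] [p' [s' [zv _ _]]] <-]]] := realL z.
  rewrite -[L in (L <= _)%N](size_mkseq (fun k => d (n + k)%N)).
  exact: size_bispecial.
have := w0E (n + L)%N; rewrite [in RHS]mkseqD [RHS]bispecial_cat -/z => w0z.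
exists u, v; split=> //.
  by apply: (factors_prefix (etrans w0z _)); rewrite zu -!catA.
by apply: (factors_prefix (etrans w0z _)); rewrite zv -!catA.
Qed.
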